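(* Let $\Gamma$ be a finite graph with vertex set $V$ and let $h:V\to\mathbb Z$, $v_i\mapsto h_i$. For $m\in\mathbb Z$, $$\chi_{\Gamma,h}(m)=\sum_{\pi\in\Pi(\Gamma)}\mu(\hat 0,\pi)\prod_{W\in\pi}[m-h(W)]^+ ,$$ where $\mu$ is the M\''obius function of $\Pi(\Gamma)$ and $h(W):=\max\{h_i: v_i\in W\}$.
   Context: $\chi_{\Gamma,h}(m)$ is the number of functions $x:V\to\mathbb Z$ such that each $x_i=x(v_i)$ lies in the integer interval $(h_i,m]=\{h_i+1,\dots,m\}$ (empty if $m\le h_i$) and no two (distinct) adjacent vertices have the same color. $\Pi(\Gamma)$ is the set of partitions $\pi$ of $V$ such that each block of $\pi$ induces a connected subgraph of $\Gamma$, ordered by refinement with the partition $\hat 0$ into singletons as its least element. For real $r$, $r^+=\max(r,0)$. *)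

(* Defs.v *)
From HB Require Import structures.
From mathcomp Require Import boolp classical_sets functions cardinality.
From mathcomp Require Import all_boot all_order all_algebra finmap zify.

Set Implicit Arguments.
Unset Strict Implicit.
Unset Printing Implicit Defensive.

Import Order.TTheory GRing.Theory Num.Theory.

Local Open Scope ring_scope.

Section Mobius.
Context {d : Order.disp_t} {T : finPOrderType d}.
Implicit Types (x y z : T) (k : nat).

Definition co_interval x y : {set T} := [set z | (x <= z)%O && (z < y)%O].

(* [k] bounds the recursion depth; #|co_interval x y| is always enough,
   since this cardinal drops when y is replaced by z in co_interval x y. The
   defining recursion of the Mobius function is recovered in [mobius_xx],
   [mobius_lt] and [mobius_sum]. *)
Fixpoint mobius_rec k x y : int :=
  if x == y then 1
  else if k is k'.+1 then - \sum_(z in co_interval x y) mobius_rec k' x z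
  else 0.

Definition mobius x y : int := mobius_rec #|co_interval x y| x y.

Lemma mobius_recE k x y :
  (#|co_interval x y| <= k)%N -> mobius_rec k x y = mobius x y.
Proof.
suff H n j : (#|co_interval x y| <= n)%N -> (#|co_interval x y| <= j)%N ->
    mobius_rec n x y = mobius_rec j x y by move=> hk; exact: H.
elim: n j y => [|n IHn] [|j] y hn hj //=; case: eqP => // _.
- rewrite big1 ?oppr0 // => z; move: hn; rewrite leqn0 cards_eq0 => /eqP->.
  by rewrite inE.
- rewrite big1 ?oppr0 // => z; move: hj; rewrite leqn0 cards_eq0 => /eqP->.
  by rewrite inE.
congr (- _); apply: eq_bigr => z; rewrite inE => /andP[xz zy].
have lt : (#|co_interval x z| < #|co_interval x y|)%N.
  apply: proper_card; apply/properP; split.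
    by apply/subsetP => w; rewrite !inE => /andP[-> /lt_trans ->].
  by exists z; rewrite !inE ?xz ?zy // ltxx andbF.
by apply: IHn; rewrite -ltnS; exact: leq_trans lt _.
Qed.

Lemma mobius_xx x : mobius x x = 1.
Proof. by rewrite /mobius; case: #|_| => [|k] /=; rewrite eqxx. Qed.

Lemma mobius_lt x y : (x < y)%O ->
  mobius x y = - \sum_(z | (x <= z)%O && (z < y)%O) mobius x z.
Proof.
move=> xy; rewrite -(mobius_recE (leqnSn _)) /= lt_eqF //; congr (- _).
apply: eq_big => [z|z]; rewrite inE // => /andP[xz zy].
apply: mobius_recE; apply: subset_leq_card.
by apply/subsetP => w; rewrite !inE => /andP[-> /lt_trans ->].
Qed.

Lemma mobius_sum x y : (x <= y)%O ->
  \sum_(z | (x <= z)%O && (z <= y)%O) mobius x z = (x == y)%:R.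
Proof.
rewrite le_eqVlt => /predU1P[<-|xy].
  rewrite eqxx (big_pred1 x) ?mobius_xx // => z /=.
  by rewrite -eq_le eq_sym.
rewrite (lt_eqF xy) (bigD1 y) /=; last by rewrite lexx ltW.
rewrite (mobius_lt xy) addrC; apply/eqP; rewrite subr_eq0; apply/eqP.
by apply: eq_bigl => z;
  rewrite -andbA [(z < y)%O]lt_neqAle [(_ != _) && _]andbC.
Qed.

Lemma mobius_nle x y : ~~ (x <= y)%O -> mobius x y = 0.
Proof.
move=> nxy; have e0 : co_interval x y = set0.
  apply/setP => z; rewrite !inE; apply/negbTE; apply: contra nxy.
  by case/andP=> xz /ltW; exact: le_trans.
rewrite /mobius e0 cards0 /=; case: eqP => // xy.
by rewrite xy lexx in nxy.
Qed.

End Mobius.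

(* A graph on V is given by its symmetric adjacency relation [e : rel V];
   [e] need not be irreflexive, so loops are allowed (and constrain nothing
   below). *)
Section Graph.
Context {V : finType}.
Implicit Types (e : rel V) (W : {set V}) (P Q : {set {set V}}).
Implicit Types (h : V -> int) (m : int).

Definition connected_in e W : bool :=
  [forall u in W, forall v in W, connect [rel x y in W | e x y] u v].

Definition refines P Q : bool :=
  [forall B in P, exists C in Q, B \subset C].

Definition is_connected_partition e P : bool :=
  partition P [set: V] && [forall W in P, connected_in e W].

(* The base point of the maximum is irrelevant ([block_max_ge],
   [block_max_mem]); blocks of a partition are nonempty, so the value 0 at
   W = set0 plays no role. *)
Definition block_max h W : int :=
  if [pick v in W] is Some v0 then \big[Num.max/h v0]_(v in W) h v else 0.

Lemma block_max_ge h W v : v \in W -> h v <= block_max h W.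
Proof.
rewrite /block_max; case: pickP => [v0 _ vW|W0 vW]; last by rewrite W0 in vW.
by rewrite (bigD1 v) //= le_max lexx.
Qed.

Lemma block_max_mem h W : W != set0 -> exists2 v, v \in W & block_max h W = h v.
Proof.
rewrite /block_max; case: pickP => [v0 v0W _|W0]; last first.
  by case/set0Pn=> v; rewrite W0.
apply: (big_ind (fun z => exists2 v, v \in W & z = h v)).
- by exists v0.
- move=> _ _ [v vW ->] [w wW ->].
  by case: (leP (h v) (h w)) => _; [exists w | exists v].
- by move=> v vW; exists v.
Qed.

Definition proper_colorings e h m : classical_sets.set {ffun V -> int} :=
  [set x : {ffun V -> int} | (forall v, h v < x v <= m) /\
     (forall u v, u != v -> e u v -> x u != x v)]%classic.

Lemma proper_colorings_finite e h m : finite_set (proper_colorings e h m).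
Proof.
pose N := (\sum_v `|m - h v|).+1%N.
pose F (f : {ffun V -> 'I_N}) : {ffun V -> int} :=
  [ffun v => h v + (f v : nat)%:Z].
apply: (@sub_finite_set _ _ (F @` [set: {ffun V -> 'I_N}])%classic); last first.
  exact/finite_image/finite_finset.
move=> x [xb _]; exists [ffun v => inord `|x v - h v|%N] => //.
apply/ffunP => v; have /andP[lo hi] := xb v; rewrite !ffunE inordK.
  by rewrite gez0_abs ?subr_ge0 ?ltW // subrKC.
by rewrite /N ltnS (bigD1 v) //=; lia.
Qed.

Definition chi e h m : nat := #|` fset_set (proper_colorings e h m)|.

End Graph.

Record connected_partition (V : finType) (e : rel V) := ConnectedPartition {
  blocks : {set {set V}};
  _ : is_connected_partition e blocks
}.

HB.instance Definition _ (V : finType) (e : rel V) :=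
  [isSub for @blocks V e].
HB.instance Definition _ (V : finType) (e : rel V) :=
  [Finite of connected_partition e by <:].

Section ConnectedPartitionOrder.
Variables (V : finType) (e : rel V).
Implicit Types p q r : connected_partition e.

Let le p q := refines (blocks p) (blocks q).

Let le_refl : reflexive le.
Proof. by move=> p; apply/forall_inP => B Bp; apply/exists_inP; exists B. Qed.

Let le_trans : transitive le.
Proof.
move=> q p r /forall_inP pq /forall_inP qr; apply/forall_inP => B /pq.
case/exists_inP=> C /qr /exists_inP[D Dr CD] BC.
apply/exists_inP; exists D => //.
exact: subset_trans BC CD.
Qed.

Let le_sub p q : le p q -> le q p -> blocks p \subset blocks q.
Proof.
move=> /forall_inP pq /forall_inP qp; apply/subsetP => B Bp.
have /exists_inP[C Cq BC] := pq _ Bp.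
have /exists_inP[D Dp CD] := qp _ Cq.
have /and3P[_ /trivIsetP tI n0] : partition (blocks p) [set: V].
  by case/andP: (valP p).
suff BD : B = D.
  by rewrite (_ : B = C) //; apply/eqP; rewrite eqEsubset BC BD CD.
apply/eqP; apply: contraT => /(tI _ _ Bp Dp).
rewrite -setI_eq0 (setIidPl (subset_trans BC CD)) => /eqP B0.
by rewrite B0 in Bp; rewrite Bp in n0.
Qed.

Let le_anti : antisymmetric le.
Proof.
by move=> p q /andP[pq qp]; apply/val_inj/eqP; rewrite eqEsubset !le_sub.
Qed.

Fact refinement_display : Order.disp_t. Proof. exact: Order.Disp tt tt. Qed.

HB.instance Definition _ := Order.Le_isPOrder.Build refinement_display
  (connected_partition e) le_refl le_anti le_trans.

Fact singletons_subproof :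
  is_connected_partition e [set [set v] | v : V].
Proof.
apply/andP; split.
  apply/and3P; split.
  - rewrite eqEsubset subsetT; apply/subsetP => v _; apply/bigcupP.
    by exists [set v]; [exact: imset_f | rewrite inE].
  - apply/trivIsetP => _ _ /imsetP[u _ ->] /imsetP[v _ ->] uv.
    by rewrite disjoints1 inE; apply: contra uv => /eqP->.
  - by apply/imsetP => -[v _ /setP/(_ v)]; rewrite !inE eqxx.
apply/forall_inP => _ /imsetP[v _ ->].
apply/forall_inP => x /set1P->; apply/forall_inP => y /set1P->.
exact: connect0.
Qed.

Definition singletons : connected_partition e :=
  ConnectedPartition singletons_subproof.

Let singletons_le p : (singletons <= p)%O.
Proof.
apply/forall_inP => _ /imsetP[v _ ->].
have /and3P[/eqP cp _ _] : partition (blocks p) [set: V].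
  by case/andP: (valP p).
have /bigcupP[B Bp vB] : v \in cover (blocks p) by rewrite cp inE.
by apply/exists_inP; exists B => //; rewrite sub1set.
Qed.

HB.instance Definition _ := Order.hasBottom.Build refinement_display
  (connected_partition e) singletons_le.

End ConnectedPartitionOrder.

Lemma le_connected_partitionE (V : finType) (e : rel V)
    (p q : connected_partition e) :
  (p <= q)%O = refines (blocks p) (blocks q).
Proof. by []. Qed.

Lemma bot_connected_partitionE (V : finType) (e : rel V) :
  blocks (\bot%O : connected_partition e) = [set [set v] | v : V].
Proof. by []. Qed.

(* Main.v *)
(* Send a colouring f to the partition pi(f) of V into the components of the
   graph formed by the monochromatic edges.  A connected partition p satisfies
   p <= pi(f) iff f is constant on the blocks of p, and pi(f) is the least
   element iff f is proper.  Hence the sum of mobius \bot p over the p on whose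
   blocks f is constant is 1 if f is proper and 0 otherwise.  Summing over the
   f with h v < f v <= m and exchanging the two sums, each p contributes
   mobius \bot p times the number of such f that are constant on its blocks,
   which is the product of the numbers of values available to each block. *)
Require Import Defs.
From mathcomp Require Import classical_sets cardinality.
From mathcomp Require Import all_boot all_order all_algebra finmap zify.

Set Implicit Arguments.
Unset Strict Implicit.
Unset Printing Implicit Defensive.

Import Order.TTheory GRing.Theory Num.Theory.
Local Open Scope ring_scope.

Definition constant_on_blocks (V : finType) (C : eqType) (P : {set {set V}})
    (f : V -> C) : bool :=
  [forall W in P, forall u in W, forall v in W, f u == f v].

Lemma constant_on_blocksP (V : finType) (C : eqType) (P : {set {set V}})
    (f : V -> C) :
  reflect (forall W u v, W \in P -> u \in W -> v \in W -> f u = f v)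
          (constant_on_blocks P f).
Proof.
apply: (iffP forall_inP) => [H W u v WP uW vW|H W WP].
  by apply/eqP; move/forall_inP: (H W WP) => /(_ u uW)/forall_inP/(_ v vW).
apply/forall_inP => u uW; apply/forall_inP => v vW.
by rewrite (H W u v).
Qed.

Lemma card_constant_on_blocks (V C : finType) (c0 : C) (P : {set {set V}})
    (A : V -> {pred C}) :
  partition P [set: V] ->
  #|[set f : {ffun V -> C} |
      constant_on_blocks P f & [forall v, f v \in A v]]| =
  (\prod_(W in P) #|[pred c | [forall v in W, c \in A v]]|)%N.
Proof.
case/and3P=> /eqP cP tP P0.
have vP v : v \in cover P by rewrite cP inE.
pose B (W : {set V}) := [pred c | [forall v in W, c \in A v]].
have -> : (\prod_(W in P) #|B W|)%N = #|pfamily c0 (mem P) B|.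
  by rewrite card_pfamily foldrE big_map big_enum.
pose F (g : {ffun {set V} -> C}) := [ffun v => g (pblock P v)].
rewrite -(card_in_imset (f := F)); last first.
  move=> g1 g2 /pfamilyP[/subsetP s1 _] /pfamilyP[/subsetP s2 _] /ffunP e12.
  apply/ffunP => W; have [WP|WP] := boolP (W \in P); last first.
    have /negPn/eqP-> := contra (s1 W) WP.
    by have /negPn/eqP-> := contra (s2 W) WP.
  have /set0Pn[v vW] : W != set0 by apply: contraNneq P0 => <-.
  by have := e12 v; rewrite !ffunE (def_pblock tP WP vW).
apply: eq_card => f; rewrite inE; apply/andP/imsetP => [[fc fA]|[g gF ->]].
  move/constant_on_blocksP: fc => fc; move/forallP: fA => fA.
  exists [ffun W => if W \in P then
      if [pick v in W] is Some v then f v else c0 else c0].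
    apply/pfamilyP; split.
      by apply/subsetP => W; rewrite inE ffunE; case: ifP => //; rewrite eqxx.
    move=> W WP; rewrite ffunE (WP : W \in P); case: pickP => [v vW|W0].
      by rewrite inE; apply/forall_inP => u uW; rewrite (fc W v u).
    by rewrite inE; apply/forall_inP => u; rewrite W0.
  apply/ffunP => v; rewrite !ffunE pblock_mem //; case: pickP => [u uW|W0].
    by apply: (fc (pblock P v)); rewrite ?pblock_mem ?mem_pblock.
  by have := W0 v; rewrite mem_pblock vP.
move/pfamilyP: gF => [_ gF]; split.
  apply/constant_on_blocksP => W u v WP uW vW.
  by rewrite !ffunE !(def_pblock tP WP).
apply/forallP => v; rewrite ffunE; have /= := gF (pblock P v) (pblock_mem (vP v)).
by rewrite inE => /forall_inP; apply; rewrite mem_pblock.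
Qed.

Section ColorClasses.
Variables (V : finType) (C : eqType) (e : rel V) (e_sym : symmetric e).
Variable f : V -> C.

Definition monochromatic_edge (u v : V) : bool := e u v && (f u == f v).
Local Arguments monochromatic_edge _ _ /.

Definition color_components : {set {set V}} :=
  equivalence_partition (connect monochromatic_edge) [set: V].

Lemma connect_mono_equiv :
  {in [set: V] & &, equivalence_rel (connect monochromatic_edge)}.
Proof.
have sc : connect_sym monochromatic_edge.
  by apply: sym_connect_sym => u v /=; rewrite e_sym eq_sym.
move=> x y z _ _ _; split=> [|xy]; first exact: connect0.
by rewrite (same_connect sc xy).
Qed.

Lemma connect_mono_color u v : connect monochromatic_edge u v -> f u = f v.
Proof.
case/connectP=> p; elim: p u => [|w p IH] u /= ; first by move=> _ ->.
by case/andP=> /andP[_ /eqP->]; exact: IH.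
Qed.

Lemma color_componentsP W :
  reflect (exists u, W = [set v | connect monochromatic_edge u v])
          (W \in color_components).
Proof.
apply: (iffP imsetP) => [[u _ ->]|[u ->]]; exists u => //;
  by apply/setP => v; rewrite !inE.
Qed.

Lemma color_components_connected : is_connected_partition e color_components.
Proof.
apply/andP; split; first exact/equivalence_partitionP/connect_mono_equiv.
apply/forall_inP => W /color_componentsP[r ->].
apply/forall_inP => u; rewrite inE => ru.
apply/forall_inP => v; rewrite inE => rv.
have := connect_mono_equiv (in_setT r) (in_setT u) (in_setT v).
case=> _ /(_ ru); rewrite rv => /esym /connectP[p].
elim: p u {rv} ru => [|w p IH] u ru /=; first by move=> _ ->.
case/andP=> uw wp vE.
have rw : connect monochromatic_edge r w.
  exact: connect_trans ru (connect1 (e := monochromatic_edge) uw).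
apply: connect_trans (IH w rw wp vE); apply: connect1.
by case/andP: uw => euw _; rewrite /= !inE ru rw.
Qed.

Definition color_partition : connected_partition e :=
  ConnectedPartition color_components_connected.

Lemma le_color_partition (p : connected_partition e) :
  (p <= color_partition)%O = constant_on_blocks (blocks p) f.
Proof.
rewrite le_connected_partitionE; apply/forall_inP/constant_on_blocksP.
  move=> H W u v /H /exists_inP[B /color_componentsP[r ->] /subsetP WB].
  move=> /WB + /WB; rewrite !inE => /connect_mono_color <-.
  exact: connect_mono_color.
case/andP: (valP p) => /and3P[_ _ P0] /forall_inP cp H W WP.
have /set0Pn[u uW] : W != set0 by apply: contraNneq P0 => <-.
apply/exists_inP; exists [set v | connect monochromatic_edge u v].
  by apply/color_componentsP; exists u.
apply/subsetP => v vW; rewrite inE.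
have /forall_inP/(_ u uW)/forall_inP/(_ v vW) := cp W WP.
apply: connect_sub => x y /= /andP[/andP[xW yW] exy]; apply: connect1.
by rewrite /= exy (H W x y) //=.
Qed.

Lemma color_partition_bot :
  (\bot%O == color_partition) =
  [forall u, forall v, (u != v) && e u v ==> (f u != f v)].
Proof.
rewrite eq_sym -lex0 le_connected_partitionE; apply/forall_inP/idP.
  move=> H; apply/forallP => u; apply/forallP => v; apply/implyP.
  case/andP=> uv euv; apply: contra uv => fuv.
  have /H/exists_inP[_ /imsetP[w _ ->] /subsetP s] :
      [set x | connect monochromatic_edge u x] \in color_components.
    by apply/color_componentsP; exists u.
  have /set1P-> : u \in [set w] by apply: s; rewrite inE connect0.
  have /set1P-> // : v \in [set w].
  by apply: s; rewrite inE; apply: connect1; rewrite /= euv.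
move=> /forallP H W /color_componentsP[u ->].
apply/exists_inP; exists [set u]; first exact: imset_f.
apply/subsetP => v; rewrite !inE => /connectP[p].
elim: p => [|w p IH] /= ; first by move=> _ ->.
case/andP=> /andP[euw fuw]; have /forallP/(_ w) := H u.
by rewrite euw fuw andbT implybF negbK => /eqP <-; exact: IH.
Qed.

End ColorClasses.

Lemma card_ord_lt n k : (k <= n)%N -> #|[pred i : 'I_n | (i < k)%N]| = k.
Proof.
by move=> kn; rewrite -sum1_card -(big_ord_widen n (fun=> 1%N)) // sum1_card card_ord.
Qed.

Section TruncatedColorings.
Variables (V : finType) (e : rel V) (h : V -> int) (m : int).

Let n := (\sum_v `|m - h v|).+1%N.

Let gap v : (`|m - h v| < n)%N.
Proof. by rewrite /n ltnS (bigD1 v) //=; lia. Qed.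

(* A colouring x is encoded by the finite function f with x v = m - f v. *)
Definition box (v : V) : {pred 'I_n} := [pred c : 'I_n | c%:Z < m - h v].

Lemma chi_card :
  chi e h m =
  #|[set f : {ffun V -> 'I_n} | [forall v, f v \in box v] &
      [forall u, forall v, (u != v) && e u v ==> (f u != f v)]]|.
Proof.
set A := [set f | _ & _].
pose F (f : {ffun V -> 'I_n}) : {ffun V -> int} := [ffun v => m - (f v)%:Z].
have F_inj : injective F.
  move=> f g /ffunP fg; apply/ffunP => v; apply: val_inj => /=.
  by have := fg v; rewrite !ffunE; lia.
have FP (x : {ffun V -> int}) :
    proper_colorings e h m x <-> exists2 f, f \in A & x = F f.
  split=> [[xb xp]|].
    have xE v : (`|m - x v| < n)%N by have := xb v; have := gap v; lia.
    have mE v : m - (inord `|m - x v| : 'I_n)%:Z = x v.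
      by rewrite inordK //; have := xb v; lia.
    exists [ffun v => inord `|m - x v|]; last by apply/ffunP => v; rewrite !ffunE.
    rewrite inE; apply/andP; split.
      by apply/forallP => v; rewrite inE ffunE; have := xb v; have := mE v; lia.
    apply/forallP => u; apply/forallP => v; apply/implyP => /andP[uv euv].
    by rewrite !ffunE; apply: contra (xp u v uv euv) => /eqP E; rewrite -mE E mE.
  case=> f; rewrite inE => /andP[/forallP fb /forallP fp] ->.
  split=> [v|u v uv euv].
    by have := fb v; rewrite inE ffunE; lia.
  have /forallP/(_ v) := fp u; rewrite uv euv /=.
  by rewrite -(inj_eq val_inj) !ffunE /=; lia.
rewrite /chi (_ : fset_set _ = [fset F f | f in A]%fset).
  by rewrite card_imfset // -cardE.
apply/fsetP => x; rewrite in_fset_set; last exact: proper_colorings_finite.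
by apply/idP/imfsetP => [/set_mem/FP|/FP/mem_set].
Qed.

Lemma card_box_block (W : {set V}) : W != set0 ->
  #|[pred c | [forall v in W, c \in box v]]|%:Z =
  Num.max (m - block_max h W) 0.
Proof.
move=> W0; have [v vW Ev] := block_max_mem h W0.
have gapv := gap v.
rewrite -[RHS]gez0_abs ?le_max ?lexx ?orbT //; congr Posz.
rewrite -[RHS](@card_ord_lt n); last by lia.
apply: eq_card => c; rewrite !inE; apply/forall_inP/idP => [|H u uW].
  by move=> /(_ v vW); rewrite inE Ev; lia.
by have := block_max_ge h uW; rewrite inE; lia.
Qed.

End TruncatedColorings.

Arguments box {V} h m v.

Theorem corollary5p1 (V : finType) (e : rel V) (e_sym : symmetric e)
    (h : V -> int) (m : int) :
  (chi e h m)%:Z =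
  \sum_(p : connected_partition e)
     mobius \bot%O p * \prod_(W in blocks p) Num.max (m - block_max h W) 0.
Proof.
pose boxed := [pred f : {ffun V -> _} | [forall v, f v \in box h m v]].
transitivity (\sum_(f | boxed f) (\bot%O == color_partition e_sym f)%:R : int).
  rewrite chi_card -natz -sum1_card natr_sum.
  under [RHS]eq_bigr do rewrite mulrb.
  rewrite -big_mkcondr.
  by apply: eq_bigl => f; rewrite inE color_partition_bot.
transitivity (\sum_(f | boxed f) \sum_(p : connected_partition e
    | constant_on_blocks (blocks p) f) mobius \bot%O p).
  apply: eq_bigr => f _; rewrite -mobius_sum ?le0x //.
  by apply: eq_bigl => p; rewrite le0x le_color_partition.
rewrite (exchange_big_dep predT) //=; apply: eq_bigr => p _.
have /andP[pP _] := valP p; have /and3P[_ _ P0] := pP.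
rewrite sumr_const -mulr_natr; congr (_ * _).
under [RHS]eq_bigr => W WP.
  rewrite -card_box_block; last by apply: contraNneq P0 => <-.
  over.
rewrite (eq_bigr _ (fun W _ => esym (natz _))) -natr_prod.
rewrite -(card_constant_on_blocks ord0 _ pP).
by congr (_%:R); apply: eq_card => f; rewrite !inE andbC.
Qed.
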